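(* Let $J,R,Q\in\mathbb{C}^{n,n}$ with $J^*=-J$, $R^*=R\ge 0$ and $Q^*=Q>0$, and let $\lambda\in\mathbb{C}$ be such that $M_\lambda:=-((J-R)Q-\lambda I_n)^{-1}$ exists. Define the $2n\times 2n$ Hermitian matrices $$H^{(\lambda)}:=\begin{bmatrix}I_n&-I_n\end{bmatrix}^*M_\lambda^*Q^2M_\lambda\begin{bmatrix}I_n&-I_n\end{bmatrix},$$ $$H_0^{(\lambda)}:=\begin{bmatrix}QM_\lambda+M_\lambda^*Q&-QM_\lambda\\ -M_\lambda^*Q&0\end{bmatrix},\qquad H_1^{(\lambda)}:=i\begin{bmatrix}0&-M_\lambda^*Q\\ Q M_\lambda&-QM_\lambda+M_\lambda^*Q\end{bmatrix}.$$ Then $$\eta^{S}(J,R,\lambda)=\left(\min_{t_0,t_1\in\mathbb{R}}\lambda_{\max}\!\left(H^{(\lambda)}+t_0H_0^{(\lambda)}+t_1H_1^{(\lambda)}\right)\right)^{-\frac12}.$$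
   Context: $\mathbb{C}^{n,n}$ is the set of complex $n\times n$ matrices; $\|\cdot\|$ is the spectral norm of a matrix; $\Lambda(A)$ is the spectrum of $A$; $\lambda_{\max}$ denotes the largest eigenvalue of a Hermitian matrix; $A\ge 0$, $A>0$ mean that $A$ is Hermitian and positive semidefinite, positive definite, respectively. For $(\Delta_J,\Delta_R)\in(\mathbb{C}^{n,n})^2$ put $|||(\Delta_J,\Delta_R)|||=\sqrt{\|\Delta_J\|^2+\|\Delta_R\|^2}$. The perturbation set is $$S(J,R)=\{(\Delta_J,\Delta_R)\in(\mathbb{C}^{n,n})^2:\ \Delta_J^*=-\Delta_J,\ \Delta_R^*=\Delta_R\},$$ and the eigenvalue backward error of $\lambda\in\mathbb{C}$ is $$\eta^{S}(J,R,\lambda)=\inf\{|||(\Delta_J,\Delta_R)|||:\ (\Delta_J,\Delta_R)\in S(J,R),\ \lambda\in\Lambda((J+\Delta_J-(R+\Delta_R))Q)\}.$$ *)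

(* Defs.v *)
From HB Require Import structures.
From mathcomp Require Import all_boot all_order all_algebra.
From mathcomp Require Import complex.
From mathcomp Require Import all_classical all_reals all_analysis.

Set Implicit Arguments.
Unset Strict Implicit.
Unset Printing Implicit Defensive.

Import Order.TTheory GRing.Theory Num.Theory.

Local Open Scope classical_set_scope.
Local Open Scope complex_scope.
Local Open Scope sesquilinear_scope.
Local Open Scope ring_scope.

(* The complex numbers are R[i] for R : realType. In R[i], 0 <= z (resp. 0 < z)
   means that z is real and nonnegative (resp. positive). *)

Definition psdmx (R : realType) n (A : 'M[R[i]]_n) : Prop :=
  A ^t* = A /\ forall x : 'cV[R[i]]_n, 0 <= (x ^t* *m A *m x) 0 0.

Definition pdmx (R : realType) n (A : 'M[R[i]]_n) : Prop :=
  A ^t* = A /\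
  forall x : 'cV[R[i]]_n, x != 0 -> 0 < (x ^t* *m A *m x) 0 0.

Definition norm2 (R : realType) n (x : 'cV[R[i]]_n) : R :=
  Num.sqrt (\sum_(k < n) Normc.normc (x k 0) ^+ 2).

(* The operator norm induced by the Euclidean norm; for n = 0 it is sup set0 = 0. *)
Definition spectral_norm (R : realType) n (A : 'M[R[i]]_n) : R :=
  sup [set norm2 (A *m x) | x in [set x : 'cV[R[i]]_n | norm2 x = 1]].

(* [eigenvalue] is stated with row vectors, v *m A = a *: v; for a square
   matrix over a field this yields the same spectrum as column vectors. *)
Definition spectrum (R : realType) n (A : 'M[R[i]]_n) : set R[i] :=
  [set z | eigenvalue A z].

(* For a Hermitian matrix of positive size the set of real eigenvalues is the
   whole spectrum, finite and nonempty, so that this sup is a maximum. *)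
Definition lambda_max (R : realType) n (A : 'M[R[i]]_n) : R :=
  sup [set x : R | spectrum A x%:C].

Definition pair_norm (R : realType) n (D : 'M[R[i]]_n * 'M[R[i]]_n) : R :=
  Num.sqrt (spectral_norm D.1 ^+ 2 + spectral_norm D.2 ^+ 2).

(* S(J, R): the structure constraints do not involve J and R. *)
Definition pert_set (R : realType) n : set ('M[R[i]]_n * 'M[R[i]]_n) :=
  [set D | D.1 ^t* = - D.1 /\ D.2 ^t* = D.2].

(* Extended-real infimum: the backward error is +oo when no admissible
   perturbation makes lambda an eigenvalue. *)
Definition backward_error (R : realType) n (J Rm Q : 'M[R[i]]_n)
    (lambda : R[i]) : \bar R :=
  ereal_inf [set (pair_norm D)%:E | D in
    [set D | @pert_set R n D /\
       spectrum ((J + D.1 - (Rm + D.2)) *m Q) lambda]].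

Definition Mlam (R : realType) n (J Rm Q : 'M[R[i]]_n) (lambda : R[i]) :
    'M[R[i]]_n :=
  - invmx ((J - Rm) *m Q - lambda%:M).

Definition Hlam (R : realType) n (Q M : 'M[R[i]]_n) : 'M[R[i]]_(n + n) :=
  let E : 'M[R[i]]_(n, n + n) := row_mx 1%:M (- 1%:M) in
  E ^t* *m M ^t* *m (Q *m Q) *m M *m E.

Definition H0lam (R : realType) n (Q M : 'M[R[i]]_n) : 'M[R[i]]_(n + n) :=
  block_mx (Q *m M + M ^t* *m Q) (- (Q *m M))
           (- (M ^t* *m Q))      0.

Definition H1lam (R : realType) n (Q M : 'M[R[i]]_n) : 'M[R[i]]_(n + n) :=
  'i%C *: block_mx 0        (- (M ^t* *m Q))
                   (Q *m M) (- (Q *m M) + M ^t* *m Q).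

(* Main.v *)
(* With w := Q M (x - y) and u = (x; y) one has u^* H u = |w|^2,
   u^* H_0 u = 2 Re (w^* x) and u^* H_1 u = 2 Im (w^* y). A skew-Hermitian
   (resp. Hermitian) matrix mapping w to x (resp. y) exists iff the second
   (resp. third) form vanishes at u, and its least spectral norm is |x|/|w|
   (resp. |y|/|w|), attained by a multiple of a Householder reflection. Hence
   eta^(-2) is the maximum of u^* H u over unit vectors u isotropic for both
   H_0 and H_1, which is at most f(t) := lambda_max (H + t_0 H_0 + t_1 H_1) for
   every t. Conversely f is coercive, so it has a minimizer; there
   subdifferentiation and the convexity of the joint numerical range of H_0 and
   H_1 on the top eigenspace (Toeplitz-Hausdorff) give a top eigenvector that is
   isotropic for both. *)
Require Import Defs.
From HB Require Import structures.
From mathcomp Require Import all_boot all_order all_algebra.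
From mathcomp Require Import complex.
From mathcomp Require Import all_classical all_reals all_analysis.
From mathcomp Require Import ring lra.

Set Implicit Arguments.
Unset Strict Implicit.
Unset Printing Implicit Defensive.

Import Order.TTheory GRing.Theory Num.Theory.
Import numFieldNormedType.Exports.

Local Open Scope classical_set_scope.
Local Open Scope complex_scope.
Local Open Scope sesquilinear_scope.
Local Open Scope ring_scope.

(** * Inner products and quadratic forms *)

Notation reC := complex.Re.
Notation imC := complex.Im.

Lemma reCD (R : realType) (a b : R[i]) : reC (a + b) = reC a + reC b.
Proof. by case: a b => ? ? []. Qed.

Lemma reC_sum (R : realType) (I : Type) (r : seq I) (F : I -> R[i]) :
  reC (\sum_(i <- r) F i) = \sum_(i <- r) reC (F i).
Proof. exact: (big_morph _ (@reCD R) erefl). Qed.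

Lemma reCM (R : realType) (a b : R[i]) :
  reC (a * b) = reC a * reC b - imC a * imC b.
Proof. by case: a b => ? ? []. Qed.

Lemma imCM (R : realType) (a b : R[i]) :
  imC (a * b) = reC a * imC b + imC a * reC b.
Proof. by case: a b => ? ? []. Qed.

Lemma reC_conj (R : realType) (a : R[i]) : reC a^* = reC a.
Proof. by case: a. Qed.

Lemma imC_conj (R : realType) (a : R[i]) : imC a^* = - imC a.
Proof. by case: a. Qed.

Lemma reCZ (R : realType) (t : R) (a : R[i]) : reC (t%:C * a) = t * reC a.
Proof. by rewrite reCM /= mul0r subr0. Qed.

Lemma conj_realC (R : realType) (t : R) : (t%:C)^* = t%:C :> R[i].
Proof. exact: conjc_real. Qed.

(* Locked, since unification would otherwise unfold the matrix products. *)
HB.lock Definition cdot (R : realType) m (x y : 'cV[R[i]]_m) : R[i] :=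
  (x ^t* *m y) 0 0.

HB.lock Definition sqnorm (R : realType) m (x : 'cV[R[i]]_m) : R :=
  reC (cdot x x).

(** For Hermitian [A] the product is already real; the real part only moves its value into the
    ordered field [R]. *)
HB.lock Definition qform (R : realType) m (A : 'M[R[i]]_m)
    (x : 'cV[R[i]]_m) : R :=
  reC (cdot x (A *m x)).

Lemma sqnormE (R : realType) m (x : 'cV[R[i]]_m) : sqnorm x = reC (cdot x x).
Proof. by rewrite sqnorm.unlock. Qed.

Lemma qformE (R : realType) m (A : 'M[R[i]]_m) x :
  qform A x = reC (cdot x (A *m x)).
Proof. by rewrite qform.unlock. Qed.

Lemma adjD (R : realType) m n (A B : 'M[R[i]]_(m, n)) :
  (A + B) ^t* = A ^t* + B ^t*.
Proof. by rewrite linearD map_mxD. Qed.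

Lemma adjN (R : realType) m n (A : 'M[R[i]]_(m, n)) : (- A) ^t* = - A ^t*.
Proof. by rewrite linearN map_mxN. Qed.

Lemma adjZ (R : realType) m n (a : R[i]) (A : 'M[R[i]]_(m, n)) :
  (a *: A) ^t* = a^* *: A ^t*.
Proof. by rewrite linearZ map_mxZ. Qed.

Lemma adjM (R : realType) m n p (A : 'M[R[i]]_(m, n)) (B : 'M[R[i]]_(n, p)) :
  (A *m B) ^t* = B ^t* *m A ^t*.
Proof. by rewrite trmx_mul map_mxM. Qed.

Lemma adj1 (R : realType) n : (1%:M : 'M[R[i]]_n) ^t* = 1%:M.
Proof. by rewrite trmx1 map_mx1. Qed.

Lemma adj_scalar (R : realType) n (t : R) :
  ((t%:C)%:M : 'M[R[i]]_n) ^t* = (t%:C)%:M.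
Proof.
by rewrite tr_scalar_mx map_scalar_mx; congr _%:M; exact: conj_realC.
Qed.

Lemma adjK (R : realType) m n (A : 'M[R[i]]_(m, n)) : A ^t* ^t* = A.
Proof. exact: trmxCK. Qed.

Lemma cdotE (R : realType) m (x y : 'cV[R[i]]_m) :
  cdot x y = \sum_k (x k 0)^* * y k 0.
Proof. by rewrite !cdot.unlock mxE; apply: eq_bigr => k _; rewrite !mxE. Qed.

Lemma cdotC (R : realType) m (x y : 'cV[R[i]]_m) : cdot y x = (cdot x y)^*.
Proof.
rewrite !cdotE rmorph_sum; apply: eq_bigr => k _.
by rewrite rmorphM mulrC; congr (_ * _); rewrite -[LHS]conjcK.
Qed.

Lemma cdotDl (R : realType) m (x y z : 'cV[R[i]]_m) :
  cdot (x + y) z = cdot x z + cdot y z.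
Proof. by rewrite !cdot.unlock adjD mulmxDl mxE. Qed.

Lemma cdotDr (R : realType) m (x y z : 'cV[R[i]]_m) :
  cdot x (y + z) = cdot x y + cdot x z.
Proof. by rewrite !cdot.unlock mulmxDr mxE. Qed.

Lemma cdotZl (R : realType) m (a : R[i]) (x y : 'cV[R[i]]_m) :
  cdot (a *: x) y = a^* * cdot x y.
Proof. by rewrite !cdot.unlock adjZ -scalemxAl mxE. Qed.

Lemma cdotZr (R : realType) m (a : R[i]) (x y : 'cV[R[i]]_m) :
  cdot x (a *: y) = a * cdot x y.
Proof. by rewrite !cdot.unlock -scalemxAr mxE. Qed.

Lemma cdotNl (R : realType) m (x y : 'cV[R[i]]_m) : cdot (- x) y = - cdot x y.
Proof. by rewrite !cdot.unlock adjN mulNmx mxE. Qed.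

Lemma cdotNr (R : realType) m (x y : 'cV[R[i]]_m) : cdot x (- y) = - cdot x y.
Proof. by rewrite !cdot.unlock mulmxN mxE. Qed.

Lemma cdot0r (R : realType) m (x : 'cV[R[i]]_m) : cdot x 0 = 0.
Proof. by rewrite !cdot.unlock mulmx0 mxE. Qed.

Lemma cdot_adj (R : realType) m n (A : 'M[R[i]]_(m, n)) x y :
  cdot x (A *m y) = cdot (A ^t* *m x) y.
Proof. by rewrite !cdot.unlock adjM adjK mulmxA. Qed.

Lemma cdot_col_mx (R : realType) m n (x y : 'cV[R[i]]_m) (x' y' : 'cV[R[i]]_n) :
  cdot (col_mx x x') (col_mx y y') = cdot x y + cdot x' y'.
Proof. by rewrite !cdot.unlock tr_col_mx map_row_mx mul_row_col mxE. Qed.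

Lemma sqnorm_sum (R : realType) m (x : 'cV[R[i]]_m) :
  sqnorm x = \sum_k (reC (x k 0) ^+ 2 + imC (x k 0) ^+ 2).
Proof.
rewrite !sqnormE cdotE reC_sum; apply: eq_bigr => k _.
by rewrite reCM reC_conj imC_conj !expr2 mulNr opprK.
Qed.

Lemma cdotxx (R : realType) m (x : 'cV[R[i]]_m) : cdot x x = (sqnorm x)%:C.
Proof.
have := cdotC x x; rewrite sqnormE; case: (cdot x x) => a b /= [].
by move=> /eqP; rewrite -addr_eq0 -mulr2n mulrn_eq0 /= => /eqP ->.
Qed.

Lemma sqnorm_ge0 (R : realType) m (x : 'cV[R[i]]_m) : 0 <= sqnorm x.
Proof. by rewrite sqnorm_sum sumr_ge0 // => k _; rewrite addr_ge0 ?sqr_ge0. Qed.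

Lemma sqnorm_eq0 (R : realType) m (x : 'cV[R[i]]_m) : sqnorm x = 0 -> x = 0.
Proof.
rewrite sqnorm_sum => /eqP; rewrite psumr_eq0 => [/allP h|k _]; last first.
  by rewrite addr_ge0 ?sqr_ge0.
apply/colP => k; rewrite mxE; have := h k (mem_index_enum _) => /=.
case: (x k 0) => a b /=; rewrite paddr_eq0 ?sqr_ge0 // !sqrf_eq0.
by move=> /andP[/eqP -> /eqP ->].
Qed.

Lemma sqnorm_gt0 (R : realType) m (x : 'cV[R[i]]_m) : x != 0 -> 0 < sqnorm x.
Proof.
move=> x0; rewrite lt_def sqnorm_ge0 andbT; apply: contra x0 => /eqP h.
by rewrite (sqnorm_eq0 h).
Qed.

Lemma sqnormZ (R : realType) m (a : R[i]) (x : 'cV[R[i]]_m) :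
  sqnorm (a *: x) = (reC a ^+ 2 + imC a ^+ 2) * sqnorm x.
Proof.
rewrite sqnormE cdotZl cdotZr cdotxx mulrA mulrC reCZ mulrC; congr (_ * _).
by rewrite reCM reC_conj imC_conj !expr2 mulNr opprK.
Qed.

Lemma norm2E (R : realType) m (x : 'cV[R[i]]_m) : norm2 x = Num.sqrt (sqnorm x).
Proof.
rewrite /norm2 sqnorm_sum; congr Num.sqrt; apply: eq_bigr => k _.
by case: (x k 0) => a b /=; rewrite sqr_sqrtr // addr_ge0 ?sqr_ge0.
Qed.

Lemma norm2_ge0 (R : realType) m (x : 'cV[R[i]]_m) : 0 <= norm2 x.
Proof. exact: sqrtr_ge0. Qed.

Lemma sqr_norm2 (R : realType) m (x : 'cV[R[i]]_m) : norm2 x ^+ 2 = sqnorm x.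
Proof. by rewrite norm2E sqr_sqrtr // sqnorm_ge0. Qed.

Lemma normalize (R : realType) m (x : 'cV[R[i]]_m) :
  x != 0 -> sqnorm ((norm2 x)^-1%:C *: x) = 1.
Proof.
move=> x0; rewrite sqnormZ /= expr0n addr0 exprVn sqr_norm2 mulVf //.
by rewrite gt_eqF // sqnorm_gt0.
Qed.

Lemma qformZ (R : realType) m (A : 'M[R[i]]_m) (a : R[i]) x :
  qform A (a *: x) = (reC a ^+ 2 + imC a ^+ 2) * qform A x.
Proof.
rewrite !qformE -scalemxAr cdotZl cdotZr mulrA -reCZ; congr reC; congr (_ * _).
by case: a => a b /=; apply/eqP; rewrite eq_complex /=; apply/andP; split;
  apply/eqP; ring.
Qed.

Lemma qform_addmx (R : realType) m (A B : 'M[R[i]]_m) x :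
  qform (A + B) x = qform A x + qform B x.
Proof. by rewrite !qformE mulmxDl cdotDr reCD. Qed.

Lemma qform_scalemx (R : realType) m (A : 'M[R[i]]_m) (t : R) x :
  qform (t%:C *: A) x = t * qform A x.
Proof. by rewrite !qformE -scalemxAl cdotZr reCZ. Qed.

Lemma qform_oppmx (R : realType) m (A : 'M[R[i]]_m) x :
  qform (- A) x = - qform A x.
Proof.
by rewrite !qformE mulNmx cdotNr; case: (cdot _ _).
Qed.

Lemma qform_scalar (R : realType) m (t : R) (x : 'cV[R[i]]_m) :
  qform (t%:C)%:M x = t * sqnorm x.
Proof. by rewrite !qformE mul_scalar_mx cdotZr reCZ sqnormE. Qed.

Lemma cdot_herm (R : realType) m (A : 'M[R[i]]_m) (x y : 'cV[R[i]]_m) :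
  A ^t* = A -> cdot y (A *m x) = (cdot x (A *m y))^*.
Proof. by move=> hA; rewrite cdotC [in RHS]cdot_adj hA. Qed.

Lemma qform_comb (R : realType) m (A : 'M[R[i]]_m) (a b : R) x y :
  A ^t* = A ->
  qform A (a%:C *: x + b%:C *: y) =
    a ^+ 2 * qform A x + 2 * a * b * reC (cdot x (A *m y)) + b ^+ 2 * qform A y.
Proof.
move=> hA; rewrite !qformE mulmxDr -!scalemxAr.
rewrite !(cdotDl, cdotDr, cdotZl, cdotZr).
rewrite !conj_realC !(reCD, reCZ) (cdot_herm x y hA) reC_conj.
by ring.
Qed.

Lemma sqnorm_comb (R : realType) m (a b : R) (x y : 'cV[R[i]]_m) :
  sqnorm (a%:C *: x + b%:C *: y) =
    a ^+ 2 * sqnorm x + 2 * a * b * reC (cdot x y) + b ^+ 2 * sqnorm y.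
Proof.
have := qform_comb a b x y (@adj1 R m); rewrite !qformE !sqnormE !mul1mx; exact.
Qed.

(** * Compactness of the unit sphere *)

(* Real coordinates of C^m, through which the compactness of bounded closed
   subsets of R^(2m) is imported. *)
Definition cvec (R : realType) m (v : 'rV[R]_(m + m)) : 'cV[R[i]]_m :=
  \col_k (v 0 (lshift m k) +i* v 0 (rshift m k)).

Lemma cvecK (R : realType) m (x : 'cV[R[i]]_m) :
  cvec (row_mx (\row_k reC (x k 0)) (\row_k imC (x k 0))) = x.
Proof.
apply/colP => k; rewrite mxE row_mxEl row_mxEr !mxE.
by case: (x k 0).
Qed.

Lemma continuous_sum (R : realType) (T : topologicalType) (I : Type)
    (r : seq I) (F : I -> T -> R) :
  (forall k, continuous (F k)) -> continuous (fun v => \sum_(k <- r) F k v).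
Proof.
move=> cF; elim: r => [|k r IH] v.
  rewrite (_ : (fun _ => _) = cst 0); first exact: cst_continuous.
  by apply/funext => z; rewrite big_nil.
rewrite (_ : (fun _ => _) = F k \+ (fun z => \sum_(j <- r) F j z)).
  by apply: continuousD; [exact: cF|exact: IH].
by apply/funext => z; rewrite big_cons.
Qed.

Lemma qform_continuous (R : realType) m (A : 'M[R[i]]_m) :
  continuous (qform A \o @cvec R m).
Proof.
have -> : qform A \o @cvec R m = fun v => \sum_k \sum_j
    (v 0 (lshift m k) * (reC (A k j) * v 0 (lshift m j)
       - imC (A k j) * v 0 (rshift m j)) +
     v 0 (rshift m k) * (reC (A k j) * v 0 (rshift m j)
       + imC (A k j) * v 0 (lshift m j))).
  apply/funext => v /=; rewrite qformE cdotE reC_sum; apply: eq_bigr => k _.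
  rewrite [(A *m _) k 0]mxE mulr_sumr reC_sum; apply: eq_bigr => j _.
  rewrite !reCM !imCM reC_conj imC_conj !mxE /=; ring.
apply: continuous_sum => k; apply: continuous_sum => j v.
have c (i : 'I_(m + m)) :
    (fun w : 'rV[R]_(m + m) => w 0 i) w @[w --> v] --> v 0 i.
  exact: coord_continuous.
have ca (a : R) (i : 'I_(m + m)) : a * w 0 i @[w --> v] --> a * v 0 i.
  exact: (cvgM (@cvg_cst _ a _ _ _) (c i)).
exact: (cvgD (cvgM (c (lshift m k)) (cvgB (ca (reC (A k j)) (lshift m j))
                                          (ca (imC (A k j)) (rshift m j))))
             (cvgM (c (rshift m k)) (cvgD (ca (reC (A k j)) (rshift m j))
                                          (ca (imC (A k j)) (lshift m j))))).
Qed.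

Lemma sqnorm_continuous (R : realType) m :
  continuous (@sqnorm R m \o @cvec R m).
Proof.
rewrite (_ : @sqnorm R m = qform 1%:M); first exact: qform_continuous.
by apply/funext => x; rewrite qformE sqnormE mul1mx.
Qed.

(** The closed condition [0 <= G x] restricts the maximization, later to a top eigenspace and to the
    vectors where another form is nonpositive. *)
Lemma sphere_EVT (R : realType) m (F G : 'cV[R[i]]_m -> R) :
  continuous (F \o @cvec R m) -> continuous (G \o @cvec R m) ->
  (exists2 x, sqnorm x = 1 & 0 <= G x) ->
  exists x, [/\ sqnorm x = 1, 0 <= G x &
    forall y, sqnorm y = 1 -> 0 <= G y -> F y <= F x].
Proof.
move=> cF cG [x0 x01 Gx0].
pose S := ((@sqnorm R m \o @cvec R m) @^-1` [set 1%R] `&`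
  (G \o @cvec R m) @^-1` [set r | 0 <= r])%classic.
have Scl : closed S.
  apply: closedI.
    by apply: closed_comp (@closed_eq _ 1) => v _; exact: sqnorm_continuous.
  by apply: closed_comp (@closed_ge _ 0) => v _; exact: cG.
(* The sphere lies in the cube [-1, 1]^(2m): the square of one coordinate is a single term of a sum
   of squares equal to 1. *)
have Sco : compact S.
  apply: subclosed_compact Scl
    (@rV_compact R (m + m) (fun=> `[(-1)%R, 1%R]%classic) _) _
    => [k|v [Sv _] k].
    exact: segment_compact.
  rewrite /= in_itv /= -ler_norml.
  rewrite -(ler_pXn2r (n := 2)) ?nnegrE // expr1n -Sv /= sqnorm_sum.
  rewrite -normrX ger0_norm ?sqr_ge0 //.
  case: (split_ordP k) => j ->; rewrite (bigD1 j) //= !mxE /=.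
    rewrite -addrA lerDl !addr_ge0 ?sqr_ge0 ?sumr_ge0 // => l _.
    by rewrite addr_ge0 ?sqr_ge0.
  rewrite addrAC lerDr !addr_ge0 ?sqr_ge0 ?sumr_ge0 // => l _.
  by rewrite addr_ge0 ?sqr_ge0.
have [| |v vS vmax] := compact_EVT_max (f := F \o @cvec R m) _ Sco.
- by exists (row_mx (\row_k reC (x0 k 0)) (\row_k imC (x0 k 0))); split;
    rewrite /= cvecK.
- by apply: continuous_subspaceT.
- exists (cvec v); move: vS; rewrite inE => -[v1 Gv]; split => // y y1 Gy.
  rewrite -[y]cvecK; apply: vmax; rewrite inE; split; by rewrite /= cvecK.
Qed.

Lemma sphere_max (R : realType) m (F : 'cV[R[i]]_m -> R) :
  continuous (F \o @cvec R m) -> (exists x : 'cV[R[i]]_m, sqnorm x = 1) ->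
  exists2 x, sqnorm x = 1 & forall y, sqnorm y = 1 -> F y <= F x.
Proof.
move=> cF [x0 x01].
have c0 : continuous ((fun=> 0 : R) \o @cvec R m).
  by move=> v; exact: (@cvg_cst _ (0 : R) _ (nbhs v)).
have [|x [x1 _ xmax]] := sphere_EVT cF c0; first by exists x0.
by exists x => // y y1; exact: xmax.
Qed.

(** * Rayleigh quotients and the largest eigenvalue *)

(** If z = A x were nonzero, a small step from x along - z would make the form negative. *)
Lemma psd_qform_eq0 (R : realType) m (A : 'M[R[i]]_m) (x : 'cV[R[i]]_m) :
  A ^t* = A -> (forall y, 0 <= qform A y) -> qform A x = 0 -> A *m x = 0.
Proof.
move=> hA psdA Ax0; apply/eqP; apply/negPn/negP => /sqnorm_gt0.
set z := A *m x => z0.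
have h t : 0 <= 2 * t * sqnorm z + t ^+ 2 * qform A z.
  have := psdA (1%:C *: x + t%:C *: z).
  rewrite qform_comb // cdot_adj hA cdotxx Ax0 /= mulr0 add0r; lra.
have q0 := psdA z; set q := qform A z in h q0.
(* The [+ 1] keeps the denominator positive when [q = 0]. At [- t] the bound [h] reads 0 <= - t^2 (q
   + 2), which is absurd. *)
pose t := sqnorm z / (q + 1).
have q1 : 0 < q + 1 by lra.
have tq : t * (q + 1) = sqnorm z by rewrite divfK // gt_eqF.
have t0 : 0 < t by rewrite divr_gt0.
have := h (- t); nra.
Qed.

(** Row and column eigenvectors exist together because A - a and its transpose have the same
    determinant. *)
Lemma eigenvalue_colP (R : realType) m (A : 'M[R[i]]_m) (a : R[i]) :
  eigenvalue A a <-> exists2 v : 'cV[R[i]]_m, v != 0 & A *m v = a *: v.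
Proof.
split=> [/eigenvalueP[v vA v0]|[v v0 Av]].
  have : \det (A - a%:M)^T == 0.
    rewrite det_tr; apply/det0P; exists v => //.
    by rewrite mulmxBr vA mul_mx_scalar subrr.
  move=> /det0P[w w0 wA]; exists w^T; first by rewrite trmx_eq0.
  apply/eqP; rewrite -subr_eq0 -mul_scalar_mx -mulmxBl.
  by rewrite -[X in X *m _]trmxK -trmx_mul wA trmx0.
have : \det (A - a%:M) == 0.
  rewrite -det_tr; apply/det0P; exists v^T; first by rewrite trmx_eq0.
  by rewrite -trmx_mul mulmxBl Av mul_scalar_mx subrr trmx0.
move=> /det0P[w w0 wA]; apply/eigenvalueP; exists w => //.
by apply/eqP; rewrite -subr_eq0 -mul_mx_scalar -mulmxBr wA.
Qed.

Lemma qform_le_sqnorm (R : realType) m (A : 'M[R[i]]_m) (c : R) :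
  (forall x, sqnorm x = 1 -> qform A x <= c) ->
  forall x, qform A x <= c * sqnorm x.
Proof.
move=> h x; have [->|x0] := eqVneq x 0.
  by rewrite sqnormE qformE mulmx0 cdot0r mulr0.
have := h _ (normalize x0).
rewrite qformZ /= expr0n addr0 exprVn sqr_norm2 ler_pdivrMl ?sqnorm_gt0 //.
by rewrite mulrC.
Qed.

Lemma sphere_nonempty (R : realType) m :
  (0 < m)%N -> exists x : 'cV[R[i]]_m, sqnorm x = 1.
Proof.
move=> m0; pose x : 'cV[R[i]]_m := const_mx 1.
have x0 : x != 0.
  apply/eqP => /colP /(_ (Ordinal m0)) /eqP; rewrite !mxE.
  by rewrite oner_eq0.
by exists ((norm2 x)^-1%:C *: x); exact: normalize.
Qed.

(** The form of c - A is nonnegative and vanishes at x, so x lies in the kernel of c - A. *)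
Lemma qform_max_eigen (R : realType) m (A : 'M[R[i]]_m) (c : R) x :
  A ^t* = A -> (forall y, qform A y <= c * sqnorm y) ->
  qform A x = c * sqnorm x -> A *m x = c%:C *: x.
Proof.
move=> hA Ac Ax; apply/esym/eqP; rewrite -subr_eq0 -mul_scalar_mx -mulmxBl.
apply/eqP; apply: psd_qform_eq0 => [|y|].
- by rewrite adjD adjN hA adj_scalar.
- by rewrite qform_addmx qform_oppmx qform_scalar subr_ge0.
- by rewrite qform_addmx qform_oppmx qform_scalar Ax subrr.
Qed.

(** Rayleigh's principle: a maximizer of the form on the unit sphere is an eigenvector, and every
    real eigenvalue is a value of the form on the sphere. *)
Lemma lambda_maxP (R : realType) m (A : 'M[R[i]]_m) :
  (0 < m)%N -> A ^t* = A ->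
  (forall x, qform A x <= lambda_max A * sqnorm x) /\
  exists2 x, sqnorm x = 1 & qform A x = lambda_max A.
Proof.
move=> m0 hA.
have [x x1 xmax] := sphere_max (@qform_continuous R m A) (sphere_nonempty R m0).
have Ac y : qform A y <= qform A x * sqnorm y.
  by apply: qform_le_sqnorm => z z1; exact: xmax.
suff -> : lambda_max A = qform A x by split=> //; exists x.
have Ax : A *m x = (qform A x)%:C *: x.
  by apply: qform_max_eigen => //; rewrite x1 mulr1.
have xS : [set t : R | spectrum A t%:C] (qform A x).
  apply/eigenvalue_colP; exists x => //; apply/eqP => x_eq0.
  by move: x1; rewrite x_eq0 sqnormE cdot0r => /eqP; rewrite eq_sym oner_eq0.
have ub : ubound [set t : R | spectrum A t%:C] (qform A x).
  move=> t /eigenvalue_colP[v v0 Av]; have := Ac v.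
  rewrite qformE Av cdotZr reCZ -sqnormE ler_pM2r //.
  exact: sqnorm_gt0.
apply/eqP; rewrite eq_le; apply/andP; split.
  by apply: ge_sup => //; exists (qform A x).
by apply: ub_le_sup => //; exists (qform A x).
Qed.

Lemma qform_bounded (R : realType) m (A : 'M[R[i]]_m) :
  exists2 c : R, 0 <= c & forall x, `|qform A x| <= c * sqnorm x.
Proof.
have ub (B : 'M[R[i]]_m) : exists c : R, forall x, qform B x <= c * sqnorm x.
  have [ne|no] := pselect (exists x : 'cV[R[i]]_m, sqnorm x = 1).
    have [x x1 xmax] := sphere_max (@qform_continuous R m B) ne.
    by exists (qform B x); apply: qform_le_sqnorm => z z1; exact: xmax.
  by exists 0; apply: qform_le_sqnorm => z z1; case: no; exists z.
have [c hc] := ub A; have [d hd] := ub (- A).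
exists (`|c| + `|d|) => [|x]; first by rewrite addr_ge0.
have := hc x; have := hd x; rewrite qform_oppmx ler_norml.
have := sqnorm_ge0 x; have := ler_norm c; have := ler_norm d.
have := normr_ge0 c; have := normr_ge0 d.
by move=> *; apply/andP; split; nra.
Qed.

(* Uniform coercivity makes the infimum over the plane one over a square. *)
Lemma coercive_min (R : realType) (f : R -> R -> R) (c0 c1 k : R) :
  0 <= c0 -> 0 <= c1 -> 0 < k ->
  (forall s0 s1 t0 t1,
    f s0 s1 <= f t0 t1 + c0 * `|s0 - t0| + c1 * `|s1 - t1|) ->
  (forall t0 t1, k * `|t0| <= f t0 t1 /\ k * `|t1| <= f t0 t1) ->
  exists t0 t1, forall s0 s1, f t0 t1 <= f s0 s1.
Proof.
move=> c00 c10 k0 flip fco.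
(* Outside the square of half-side r, coercivity gives f > k r = f 0 0, so a minimizer over the
   square is global. *)
pose r := (f 0 0) / k.
have f00 : k * r = f 0 0 by rewrite mulrC divfK // gt_eqF.
have r0 : 0 <= r by have [] := fco 0 0; rewrite normr0 mulr0 => ? _; nra.
pose g (p : R * R) := f p.1 p.2.
have cg : continuous g.
  move=> p; apply/cvgrPdist_lt => e e0.
  pose d := e / (c0 + c1 + 1).
  have s0 : 0 < c0 + c1 + 1 by lra.
  have d0 : 0 < d by rewrite divr_gt0.
  have dE : d * (c0 + c1 + 1) = e by rewrite divfK // gt_eqF.
  have n0 : \forall q \near nbhs p, `|p.1 - q.1| < d.
    by have /cvgrPdist_lt/(_ d d0) : fst q @[q --> p] --> p.1 by exact: cvg_fst.
  have n1 : \forall q \near nbhs p, `|p.2 - q.2| < d.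
    by have /cvgrPdist_lt/(_ d d0) : snd q @[q --> p] --> p.2 by exact: cvg_snd.
  near=> q.
  have h0 : `|p.1 - q.1| < d by near: q.
  have h1 : `|p.2 - q.2| < d by near: q.
  have := flip p.1 p.2 q.1 q.2; have := flip q.1 q.2 p.1 p.2.
  rewrite (distrC q.1) (distrC q.2) -/(g p) -/(g q) ltr_norml => *.
  by apply/andP; split; nra.
have [| |p pS pmin] := @compact_EVT_min _ R g
    (`[- r, r]%classic `*` `[- r, r]%classic) _ _ (continuous_subspaceT cg).
- by exists (0, 0); split; rewrite /= in_itv /= lerNl oppr0 r0.
- by apply: compact_setX; exact: segment_compact.
exists p.1, p.2 => s0 s1; rewrite -/(g p) -[f s0 s1]/(g (s0, s1)).
have [sr|] := boolP ((`|s0| <= r) && (`|s1| <= r)).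
  apply: pmin; rewrite inE; case/andP: sr => a b.
  by split; rewrite /= in_itv /= -ler_norml.
have g0 : g p <= f 0 0.
  apply: (pmin (0, 0)); rewrite inE.
  by split; rewrite /= in_itv /= lerNl oppr0 r0.
have [h0 h1] := fco s0 s1; rewrite -/(g (s0, s1)) in h0 h1 *.
by rewrite negb_and -!ltNge => /orP[] h; nra.
Unshelve. all: by end_near.
Qed.

(** * Toeplitz-Hausdorff theorem for pairs of Hermitian forms *)

(** For z != 0 the phase is i conj(z) / |z|, which sends z to i |z|. *)
Lemma exists_phase (R : realType) (z : R[i]) :
  exists2 e : R[i], reC e ^+ 2 + imC e ^+ 2 = 1 & reC (e * z) = 0.
Proof.
case: z => a b; have [ab0|ab0] := eqVneq (a ^+ 2 + b ^+ 2) 0.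
  move: ab0 => /eqP; rewrite paddr_eq0 ?sqr_ge0 // !sqrf_eq0.
  move=> /andP[/eqP -> /eqP ->]; exists 1; last by rewrite mul1r.
  by rewrite /= expr1n expr0n addr0.
have ab_gt0 : 0 < a ^+ 2 + b ^+ 2.
  by rewrite lt_def ab0 addr_ge0 ?sqr_ge0.
exists ((Num.sqrt (a ^+ 2 + b ^+ 2))^-1%:C * (b +i* a)).
  rewrite reCZ imCM /= mul0r addr0 !exprMn exprVn sqr_sqrtr ?(ltW ab_gt0) //.
  by rewrite -mulrDr [b ^+ 2 + _]addrC mulVf.
by rewrite -mulrA reCZ reCM /= [b * a]mulrC subrr mulr0.
Qed.

(* A real quadratic form of nonnegative discriminant is isotropic: this gives
   the point z = a x + b y of the segment in the convexity proof below. *)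
Lemma isotropic_vector (R : realType) (c rho s : R) : 0 <= s <= 1 ->
  exists a b, (a, b) != (0, 0) /\
    2 * a * b * rho + b ^+ 2 = s * (a ^+ 2 + 2 * a * b * c + b ^+ 2).
Proof.
move=> /andP[s0 s1]; have [->|sn0] := eqVneq s 0.
  exists 1, 0; split; last by ring.
  by rewrite xpair_eqE oner_eq0.
(* With b = s and s != 0 the equation divides by s to a^2 + 2 h a - s (1 - s) = 0, of which q - h is
   a root. *)
pose h := s * c - rho.
have D0 : 0 <= h ^+ 2 + s * (1 - s).
  by rewrite addr_ge0 ?sqr_ge0 // mulr_ge0 // subr_ge0.
pose q := Num.sqrt (h ^+ 2 + s * (1 - s)).
have qE : q ^+ 2 = h ^+ 2 + s * (1 - s) by rewrite sqr_sqrtr.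
exists (q - h), s; split; first by rewrite xpair_eqE (negbTE sn0) andbF.
have -> : s * ((q - h) ^+ 2 + 2 * (q - h) * s * c + s ^+ 2) =
  s * (q ^+ 2 - 2 * q * h + h ^+ 2 + 2 * (q - h) * s * c + s ^+ 2) by ring.
by rewrite qE /h; ring.
Qed.

(** Here c stands for Re x^* y, r and r' for the real cross terms of two forms, a and b for their
    values at x, d and d' for the increments towards y. Since (r - c a, r' - c b) is a multiple rho
    of (d, d'), both equations reduce to the one solved by [isotropic_vector]. *)
Lemma segment_weights (R : realType) (a b d d' c r r' s : R) :
  d ^+ 2 + d' ^+ 2 != 0 -> d' * (r - c * a) = d * (r' - c * b) ->
  0 <= s <= 1 ->
  exists al be, let N := al ^+ 2 + 2 * al * be * c + be ^+ 2 in
    [/\ (al, be) != (0, 0),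
      al ^+ 2 * a + 2 * al * be * r + be ^+ 2 * (a + d) = (a + s * d) * N &
      al ^+ 2 * b + 2 * al * be * r' + be ^+ 2 * (b + d') = (b + s * d') * N].
Proof.
move=> dd0 par s01.
have [rho [rE r'E]] : exists rho, r = rho * d + c * a /\ r' = rho * d' + c * b.
  exists ((d * (r - c * a) + d' * (r' - c * b)) / (d ^+ 2 + d' ^+ 2)).
  split; apply/eqP; rewrite -subr_eq; apply/eqP; apply: (mulIf dd0).
    rewrite [RHS]mulrAC divfK // [RHS]mulrDl -!mulrA [(r' - _) * d]mulrC -par.
    by ring.
  rewrite [RHS]mulrAC divfK // [RHS]mulrDl -!mulrA [(r - _) * d']mulrC par.
  by ring.
have [al [be [ab0 iso]]] := isotropic_vector c rho s01.
exists al, be; split=> //.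
  by rewrite [RHS]mulrDl [s * d * _]mulrAC -iso rE; ring.
by rewrite [RHS]mulrDl [s * d' * _]mulrAC -iso r'E; ring.
Qed.

(** A phase change of y makes the cross terms parallel to the segment, which real combinations then
    reach. The predicate [P] allows restriction to an eigenspace. *)
Lemma joint_range_convex (R : realType) m (A B : 'M[R[i]]_m)
    (P : 'cV[R[i]]_m -> Prop) (x y : 'cV[R[i]]_m) (s : R) :
  A ^t* = A -> B ^t* = B ->
  (forall a b u v, P u -> P v -> P (a *: u + b *: v)) ->
  P x -> P y -> sqnorm x = 1 -> sqnorm y = 1 -> 0 <= s <= 1 ->
  exists z, [/\ P z, sqnorm z = 1,
    qform A z = qform A x + s * (qform A y - qform A x) &
    qform B z = qform B x + s * (qform B y - qform B x)].
Proof.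
move=> hA hB Plin Px Py x1 y1 s01.
have [dd0|dd0] := eqVneq
    ((qform A y - qform A x) ^+ 2 + (qform B y - qform B x) ^+ 2) 0.
  move/eqP: dd0; rewrite paddr_eq0 ?sqr_ge0 // !sqrf_eq0.
  by move=> /andP[/eqP -> /eqP ->]; exists x; rewrite !mulr0 !addr0.
have [y' [Py' y'1 qy' par]] : exists y', [/\ P y', sqnorm y' = 1,
    forall C, qform C y' = qform C y &
    (qform B y - qform B x) *
      (reC (cdot x (A *m y')) - reC (cdot x y') * qform A x) =
    (qform A y - qform A x) *
      (reC (cdot x (B *m y')) - reC (cdot x y') * qform B x)].
  move: (qform A x) (qform B x) (qform A y - _) (qform B y - _) => a b d d'.
  (* The parallelism condition is real linear in the phase e: it says that e times this number has
     real part zero. *)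
  have [e e1 ew] := exists_phase (d'%:C * cdot x (A *m y) +
    (- d)%:C * cdot x (B *m y) + (d * b - d' * a)%:C * cdot x y).
  exists (e *: y); split.
  - by have := Plin e 0 y y Py Py; rewrite scale0r addr0.
  - by rewrite sqnormZ e1 mul1r.
  - by move=> C; rewrite qformZ e1 mul1r.
  rewrite -!scalemxAr !cdotZr; apply/eqP; rewrite -subr_eq0 -ew !mulrDr.
  rewrite ![e * (_%:C * _)]mulrCA !(reCD, reCZ); apply/eqP.
  by ring.
have [al [be [ab0 wA wB]]] := segment_weights dd0 par s01.
pose z := al%:C *: x + be%:C *: y'.
have zN : sqnorm z = al ^+ 2 + 2 * al * be * reC (cdot x y') + be ^+ 2.
  by rewrite sqnorm_comb x1 y'1 !mulr1.
have zA : qform A z = (qform A x + s * (qform A y - qform A x)) * sqnorm z.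
  by rewrite qform_comb // qy' zN -wA subrKC.
have zB : qform B z = (qform B x + s * (qform B y - qform B x)) * sqnorm z.
  by rewrite qform_comb // qy' zN -wB subrKC.
(* If z = 0, then x and y' differ by a factor of modulus 1, so all forms agree at x and y, against
   [dd0]. *)
have z0 : z != 0.
  apply/eqP => z0.
  have xy : al%:C *: x = (- be)%:C *: y'.
    by apply/eqP; rewrite -subr_eq0 rmorphN scaleNr opprK -/z z0.
  have := congr1 (@sqnorm _ _) xy; rewrite [LHS]sqnormZ [RHS]sqnormZ x1 y'1.
  rewrite /= !expr0n !addr0.
  rewrite !mulr1 sqrrN => ab.
  have al0 : al ^+ 2 != 0.
    apply: contra ab0 => al0; move: (al0); rewrite ab !sqrf_eq0 => /eqP ->.
    by move: al0; rewrite sqrf_eq0 => /eqP ->.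
  have qxy C : qform C x = qform C y.
    have := congr1 (qform C) xy; rewrite [LHS]qformZ [RHS]qformZ qy' /=.
    by rewrite expr0n /= !addr0 sqrrN -ab => /(mulfI al0).
  by move: dd0; rewrite !qxy !subrr expr0n addr0 eqxx.
have n0 := sqnorm_gt0 z0.
exists ((norm2 z)^-1%:C *: z); split.
- have Pz : P z by exact: Plin.
  by have := Plin (norm2 z)^-1%:C 0 z z Pz Pz; rewrite scale0r addr0.
- exact: normalize.
- by rewrite qformZ /= expr0n addr0 exprVn sqr_norm2 zA mulrC mulfK // gt_eqF.
- by rewrite qformZ /= expr0n addr0 exprVn sqr_norm2 zB mulrC mulfK // gt_eqF.
Qed.

(** * Minimization of the largest eigenvalue of a pencil *)

Section PencilOfThree.

Variables (R : realType) (m : nat) (H H0 H1 : 'M[R[i]]_m).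
Hypotheses (m_gt0 : (0 < m)%N) (hH : H ^t* = H) (hH0 : H0 ^t* = H0)
  (hH1 : H1 ^t* = H1).

Let pencil (t0 t1 : R) := H + t0%:C *: H0 + t1%:C *: H1.

Lemma pencil_herm t0 t1 : (pencil t0 t1) ^t* = pencil t0 t1.
Proof. by rewrite !adjD !adjZ !conj_realC hH hH0 hH1. Qed.

Lemma qform_pencil t0 t1 x :
  qform (pencil t0 t1) x = qform H x + t0 * qform H0 x + t1 * qform H1 x.
Proof. by rewrite !qform_addmx !qform_scalemx. Qed.

Lemma qform_pencil_le t0 t1 x :
  qform H x + t0 * qform H0 x + t1 * qform H1 x <=
    lambda_max (pencil t0 t1) * sqnorm x.
Proof.
have [le_max _] := lambda_maxP m_gt0 (pencil_herm t0 t1).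
by rewrite -qform_pencil.
Qed.

(** A unit vector attaining the maximum at (s0, s1) serves as a test vector at (t0, t1), and the
    forms of H0 and H1 are bounded on the sphere. *)
Lemma lambda_max_lipschitz : exists c0 c1 : R, [/\ 0 <= c0, 0 <= c1 &
  forall s0 s1 t0 t1, lambda_max (pencil s0 s1) <=
    lambda_max (pencil t0 t1) + c0 * `|s0 - t0| + c1 * `|s1 - t1|].
Proof.
have [c0 c00 hc0] := qform_bounded H0; have [c1 c10 hc1] := qform_bounded H1.
exists c0, c1; split=> // s0 s1 t0 t1.
have [_ [x x1 <-]] := lambda_maxP m_gt0 (pencil_herm s0 s1).
have := qform_pencil_le t0 t1 x; have := hc0 x; have := hc1 x.
rewrite qform_pencil x1 !mulr1 => h1 h0 h.
have e0 : (s0 - t0) * qform H0 x <= c0 * `|s0 - t0|.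
  by rewrite (le_trans (ler_norm _)) // normrM mulrC ler_wpM2r.
have e1 : (s1 - t1) * qform H1 x <= c1 * `|s1 - t1|.
  by rewrite (le_trans (ler_norm _)) // normrM mulrC ler_wpM2r.
lra.
Qed.

(* Moving from (t0, t1) against the point p of least norm of the joint range
   over the top eigenspace would decrease [lambda_max] unless p = 0. *)
Lemma lambda_max_min_isotropic t0 t1 :
  (forall s0 s1, lambda_max (pencil t0 t1) <= lambda_max (pencil s0 s1)) ->
  exists x, [/\ sqnorm x = 1, qform H0 x = 0, qform H1 x = 0 &
    qform H x = lambda_max (pencil t0 t1)].
Proof.
set mu := lambda_max _ => tmin.
have [gmax [v v1 gv]] := lambda_maxP m_gt0 (pencil_herm t0 t1).
rewrite -/mu in gmax gv.
pose V (x : 'cV[R[i]]_m) := pencil t0 t1 *m x = mu%:C *: x.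
have VP x : qform (pencil t0 t1) x = mu * sqnorm x -> V x.
  by move=> ?; apply: qform_max_eigen => //; exact: pencil_herm.
have qV x : V x -> qform (pencil t0 t1) x = mu * sqnorm x.
  by move=> Vx; rewrite qformE Vx cdotZr reCZ sqnormE.
have Vlin a b x y : V x -> V y -> V (a *: x + b *: y).
  move=> Vx Vy; rewrite /V mulmxDr -!scalemxAr Vx Vy scalerDr.
  by rewrite !scalerA ![_ * mu%:C]mulrC.
pose F (x : 'cV[R[i]]_m) := - (qform H0 x ^+ 2 + qform H1 x ^+ 2).
have cF : continuous (F \o @cvec R m).
  move=> x; have c0 := @qform_continuous R m H0 x.
  have c1 := @qform_continuous R m H1 x.
  exact: (cvgN (cvgD (cvgM c0 c0) (cvgM c1 c1))).
have gap x : qform (pencil t0 t1 - (mu%:C)%:M) x =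
    qform (pencil t0 t1) x - mu * sqnorm x.
  by rewrite qform_addmx qform_oppmx qform_scalar.
(* This form is at most 0, so requiring it to be nonnegative selects exactly the top eigenspace. *)
have [|p [p1 Gp pmin]] := sphere_EVT cF
  (@qform_continuous R m (pencil t0 t1 - (mu%:C)%:M)).
  by exists v => //; rewrite gap gv v1 mulr1 subrr.
have Vp : V p.
  apply: VP; apply/eqP; rewrite eq_le gmax /=.
  by move: Gp; rewrite gap subr_ge0.
set a := qform H0 p in pmin; set b := qform H1 p in pmin.
have [ab0|ab0] := eqVneq (a ^+ 2 + b ^+ 2) 0.
  move/eqP: ab0; rewrite paddr_eq0 ?sqr_ge0 // !sqrf_eq0.
  move=> /andP[/eqP a0 /eqP b0]; exists p; split=> //.
  have := qV p Vp; rewrite qform_pencil -/a -/b a0 b0 p1 !mulr0 !addr0 mulr1.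
  exact.
have ab_gt0 : 0 < a ^+ 2 + b ^+ 2 by rewrite lt_def ab0 addr_ge0 ?sqr_ge0.
(* Variational inequality for the point (a, b) of least norm in a convex set. *)
have Vpos x : V x -> sqnorm x = 1 ->
    a ^+ 2 + b ^+ 2 <= a * qform H0 x + b * qform H1 x.
  move=> Vx x1; rewrite leNgt; apply/negP => lt_ab.
  pose d := qform H0 x - a; pose d' := qform H1 x - b.
  pose k := - (a * d + b * d').
  have k0 : 0 < k by rewrite /k /d /d'; lra.
  pose D := d ^+ 2 + d' ^+ 2.
  have D0 : 0 <= D by rewrite addr_ge0 ?sqr_ge0.
  (* A move by s towards x changes the squared norm by s (- 2 k + s D), and s D < k for this s. *)
  pose s := k / (k + D).
  have kD : 0 < k + D by lra.
  have sE : s * (k + D) = k by rewrite divfK // gt_eqF.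
  have s0 : 0 < s by rewrite divr_gt0.
  have s1 : s <= 1 by rewrite ler_pdivrMr // mul1r lerDl.
  have [|z [Vz z1 zA zB]] :=
    @joint_range_convex _ _ H0 H1 V p x s hH0 hH1 Vlin Vp Vx p1 x1.
    by rewrite (ltW s0).
  have := pmin z z1; rewrite gap (qV z Vz) subrr => /(_ (lexx _)).
  rewrite lerN2 zA zB -/a -/b -/d -/d' => le_ab.
  have : 0 <= s * (- 2 * k + s * D).
    have -> : s * (- 2 * k + s * D) =
      (a + s * d) ^+ 2 + (b + s * d') ^+ 2 - (a ^+ 2 + b ^+ 2).
      by rewrite /k /D; ring.
    by rewrite subr_ge0.
  rewrite pmulr_rge0 // => h; nra.
pose K := a%:C *: H0 + b%:C *: H1.
have qK x : qform K x = a * qform H0 x + b * qform H1 x.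
  by rewrite qform_addmx !qform_scalemx.
(* By minimality, a top vector after the step - e (a, b) still reaches mu; as its form at (t0, t1)
   is at most mu, K is nonpositive on it. *)
have step e : 0 < e -> exists x, [/\ sqnorm x = 1, qform K x <= 0 &
    mu <= qform (pencil t0 t1) x - e * qform K x].
  move=> e0; have [_ [x x1 xmax]] :=
    lambda_maxP m_gt0 (pencil_herm (t0 - e * a) (t1 - e * b)).
  have : mu <= qform (pencil t0 t1) x - e * qform K x.
    have := tmin (t0 - e * a) (t1 - e * b); rewrite -xmax.
    rewrite !qform_pencil qK => h; apply: le_trans h _.
    by rewrite le_eqVlt; apply/orP; left; apply/eqP; ring.
  move=> h; exists x; split=> //; have := gmax x; rewrite x1 mulr1 => gx.
  by rewrite leNgt; apply/negP => Kx; have := mulr_gt0 e0 Kx; lra.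
have [x0 [x01 Kx0 _]] := step 1 ltr01.
have [|u [u1 Ku umax]] := sphere_EVT (@qform_continuous R m (pencil t0 t1))
  (@qform_continuous R m (- K)).
  by exists x0 => //; rewrite qform_oppmx oppr_ge0.
(* Equality would put u in the top eigenspace, where K >= a^2 + b^2 > 0. *)
have gu : qform (pencil t0 t1) u < mu.
  rewrite lt_neqAle; apply/andP; split; last first.
    by have := gmax u; rewrite u1 mulr1.
  apply/eqP => gu; have Vu : V u by apply: VP; rewrite u1 mulr1.
  have := Vpos u Vu u1; rewrite -qK; move: Ku; rewrite qform_oppmx; lra.
have [C C0 KC] := qform_bounded K.
(* For this step length - e K <= e C stays strictly below the gap between mu and the value at u. *)
pose e := (mu - qform (pencil t0 t1) u) / (C + 1).
have C1 : 0 < C + 1 by lra.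
have e0 : 0 < e by rewrite divr_gt0 // subr_gt0.
have eE : e * (C + 1) = mu - qform (pencil t0 t1) u by rewrite divfK // gt_eqF.
have [x [x1 Kx hx]] := step e e0.
have := umax x x1; rewrite qform_oppmx oppr_ge0 => /(_ Kx) gx.
have := KC x; rewrite x1 mulr1 ler_norml => /andP[Kge _].
nra.
Qed.

End PencilOfThree.

(** * Structured mappings of minimal norm *)

Lemma imC_herm (R : realType) m (D : 'M[R[i]]_m) (w : 'cV[R[i]]_m) :
  D ^t* = D -> imC (cdot w (D *m w)) = 0.
Proof.
move=> hD; have := cdot_herm w w hD; case: (cdot _ _) => a b [].
by move=> /eqP; rewrite -addr_eq0 -mulr2n mulrn_eq0 /= => /eqP.
Qed.

Lemma reC_skew (R : realType) m (D : 'M[R[i]]_m) (w : 'cV[R[i]]_m) :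
  D ^t* = - D -> reC (cdot w (D *m w)) = 0.
Proof.
move=> hD; have := cdotC (D *m w) w; rewrite [in LHS]cdot_adj hD mulNmx cdotNl.
rewrite cdotC; case: (cdot w _) => a b [].
by move=> /eqP; rewrite eq_sym -addr_eq0 -mulr2n mulrn_eq0 /= => /eqP.
Qed.

Lemma sqnorm_addZ (R : realType) m (x y : 'cV[R[i]]_m) (a : R[i]) :
  sqnorm (x - a *: y) = sqnorm x - 2 * reC (a * cdot x y) +
    (reC a ^+ 2 + imC a ^+ 2) * sqnorm y.
Proof.
rewrite -sqnormZ !sqnormE !(cdotDl, cdotDr, cdotNl, cdotNr, cdotZl, cdotZr).
rewrite (cdotC x y) -rmorphM !reCD.
have reCN (z : R[i]) : reC (- z) = - reC z by case: z.
by rewrite mulrN !reCN reC_conj; ring.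
Qed.

(* The reflection exchanging x and y when they have equal norms; it exists
   over the complex numbers precisely because x^* y is real. *)
Lemma householder (R : realType) m (x y : 'cV[R[i]]_m) :
  sqnorm x = sqnorm y -> imC (cdot x y) = 0 ->
  exists U : 'M[R[i]]_m, [/\ U ^t* = U, U *m x = y &
    forall z, sqnorm (U *m z) = sqnorm z].
Proof.
move=> xy imxy; have [->|xNy] := eqVneq x y.
  by exists 1%:M; split=> [||z]; rewrite ?adj1 ?mul1mx.
pose d := x - y; have d0 : 0 < sqnorm d by rewrite sqnorm_gt0 // subr_eq0.
pose c := 2 / sqnorm d.
have cE : c * sqnorm d = 2 by rewrite divfK // gt_eqF.
have Uz z : (1%:M - c%:C *: (d *m d ^t*)) *m z = z - (c%:C * cdot d z) *: d.
  rewrite mulmxBl mul1mx -scalemxAl -mulmxA -scalerA cdot.unlock.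
  by rewrite [d ^t* *m z]mx11_scalar mul_mx_scalar !mxE eqxx.
exists (1%:M - c%:C *: (d *m d ^t*)); split.
- by rewrite adjD adjN adjZ adjM adjK adj1 conj_realC.
- rewrite Uz.
  have -> : c%:C * cdot d x = 1.
    (* Equal norms and a real x^* y give |d|^2 = 2 (|x|^2 - x^* y), so d^* x is half of |d|^2. *)
    have dx : cdot d x = (sqnorm d / 2)%:C.
      have dE : sqnorm d = 2 * sqnorm x - 2 * reC (cdot x y).
        rewrite /d -[y]scale1r sqnorm_addZ scale1r mul1r /= expr1n expr0n addr0.
        by rewrite mul1r -xy; ring.
      rewrite dE /d cdotDl cdotNl cdotxx (cdotC x y).
      move: imxy; case: (cdot x y) => a b /= ->.
      by apply/eqP; rewrite eq_complex /=; apply/andP; split; apply/eqP; field.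
    by rewrite dx -rmorphM mulrA cE mulfV // pnatr_eq0.
  by rewrite scale1r /d subKr.
- move=> z; rewrite Uz sqnorm_addZ cdotC; case: (cdot z d) => p q.
  rewrite !(reCM, imCM) /=.
  rewrite (_ : _ + _ = sqnorm z - c * (p ^+ 2 + q ^+ 2) * (2 - c * sqnorm d)).
    by rewrite cE subrr mulr0 subr0.
  by ring.
Qed.

Lemma spectral_norm_ge (R : realType) n (A : 'M[R[i]]_n) x :
  sqnorm (A *m x) <= spectral_norm A ^+ 2 * sqnorm x.
Proof.
have qA y : qform (A ^t* *m A) y = sqnorm (A *m y).
  by rewrite qformE sqnormE -mulmxA cdot_adj adjK.
have [c c0 hc] := qform_bounded (A ^t* *m A).
have [->|x0] := eqVneq x 0.
  by rewrite mulmx0 !sqnormE !cdot0r mulr0.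
rewrite -ler_pdivrMr ?sqnorm_gt0 //.
have -> : sqnorm (A *m x) / sqnorm x =
    norm2 (A *m ((norm2 x)^-1%:C *: x)) ^+ 2.
  rewrite sqr_norm2 -scalemxAr sqnormZ /= expr0n addr0 exprVn sqr_norm2.
  by rewrite mulrC.
have le_s : norm2 (A *m ((norm2 x)^-1%:C *: x)) <= spectral_norm A.
  (* An element lies below [sup] only once the set is known to be bounded; the form of A^* A
     provides the bound. *)
  apply: ub_le_sup.
    exists (Num.sqrt c) => _ [y /= y1 <-]; rewrite norm2E ler_wsqrtr //.
    have := hc y; rewrite qA -(sqr_norm2 y) y1 expr1n mulr1.
    by apply: le_trans; exact: ler_norm.
  exists ((norm2 x)^-1%:C *: x) => //=.
  by rewrite norm2E normalize // sqrtr1.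
apply: lerXn2r => //; rewrite nnegrE ?norm2_ge0 //.
exact: le_trans (norm2_ge0 _) le_s.
Qed.

Lemma spectral_norm_scaled_isometry (R : realType) n (A : 'M[R[i]]_n) (a : R) :
  (0 < n)%N -> 0 <= a -> (forall x, sqnorm (A *m x) = a ^+ 2 * sqnorm x) ->
  spectral_norm A = a.
Proof.
move=> n0 a0 hA; rewrite /spectral_norm -[RHS]sup1; congr sup.
have nA x : norm2 x = 1 -> norm2 (A *m x) = a.
  move=> x1; rewrite norm2E hA -(sqr_norm2 x) x1 expr1n mulr1 sqrtr_sqr.
  by rewrite ger0_norm.
apply/seteqP; split=> [_ [x /= x1 <-]|_ ->]; first exact: nA.
have [x x1] := sphere_nonempty R n0.
have x2 : norm2 x = 1 by rewrite norm2E x1 sqrtr1.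
by exists x => //; exact: nA.
Qed.

(** With a = |u| / |w|, the vectors a w and u have equal norms, so a reflection U takes one to the
    other; a U is then a scaled isometry mapping w to u. *)
Lemma herm_map_min_norm (R : realType) n (w u : 'cV[R[i]]_n) :
  (0 < n)%N -> w != 0 -> imC (cdot w u) = 0 ->
  exists D : 'M[R[i]]_n, [/\ D ^t* = D, D *m w = u &
    spectral_norm D ^+ 2 * sqnorm w = sqnorm u].
Proof.
move=> n0 w0 imwu; have w0' := sqnorm_gt0 w0.
pose a := norm2 u / norm2 w.
have a0 : 0 <= a by rewrite divr_ge0 // norm2_ge0.
have a2 : a ^+ 2 * sqnorm w = sqnorm u.
  by rewrite /a expr_div_n !sqr_norm2 divfK // gt_eqF.
have [||U [hU Uw isoU]] := @householder _ _ (a%:C *: w) u.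
- by rewrite sqnormZ /= expr0n addr0.
- by rewrite cdotZl conj_realC imCM imwu /= mulr0 mul0r addr0.
exists (a%:C *: U); split.
- by rewrite adjZ conj_realC hU.
- by rewrite -scalemxAl scalemxAr.
rewrite (@spectral_norm_scaled_isometry _ _ _ a) // => x.
by rewrite -scalemxAl sqnormZ /= expr0n addr0 isoU.
Qed.

Lemma spectral_norm_scale_i (R : realType) n (A : 'M[R[i]]_n) :
  spectral_norm ('i%C *: A) = spectral_norm A.
Proof.
rewrite /spectral_norm; congr sup; apply: eq_imagel => x _.
by rewrite !norm2E -scalemxAl sqnormZ /= expr0n add0r expr1n mul1r.
Qed.

(** Multiplication by i turns a Hermitian map sending w to - i u into a skew-Hermitian one sending w
    to u, with the same norm. *)
Lemma skew_map_min_norm (R : realType) n (w u : 'cV[R[i]]_n) :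
  (0 < n)%N -> w != 0 -> reC (cdot w u) = 0 ->
  exists D : 'M[R[i]]_n, [/\ D ^t* = - D, D *m w = u &
    spectral_norm D ^+ 2 * sqnorm w = sqnorm u].
Proof.
move=> n0 w0 rewu.
have [|D [hD Dw normD]] := @herm_map_min_norm _ _ w ((- 'i%C) *: u) n0 w0.
  by rewrite cdotZr imCM rewu /= mulr0 oppr0 mul0r addr0.
exists ('i%C *: D); split.
- rewrite adjZ hD -scaleNr; congr (_ *: _).
  by apply/eqP; rewrite eq_complex /= oppr0 !eqxx.
- by rewrite -scalemxAl Dw scalerA mulrN -expr2 sqr_i opprK scale1r.
- rewrite spectral_norm_scale_i normD sqnormZ /= oppr0 expr0n add0r sqrrN.
  by rewrite expr1n mul1r.
Qed.

(** * Backward errors *)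

Section Pencil.

Variables (R : realType) (n : nat) (Q M : 'M[R[i]]_n).
Hypothesis hQ : Q ^t* = Q.

Let w (x y : 'cV[R[i]]_n) := Q *m M *m (x - y).

Lemma adj_block_mx m1 m2 (A : 'M[R[i]]_m1) B C (D : 'M[R[i]]_m2) :
  (block_mx A B C D) ^t* = block_mx (A ^t*) (C ^t*) (B ^t*) (D ^t*).
Proof. by rewrite tr_block_mx map_block_mx. Qed.

Lemma adj0 m1 m2 : (0 : 'M[R[i]]_(m1, m2)) ^t* = 0.
Proof. by rewrite trmx0 map_mx0. Qed.

Lemma Hlam_herm : (Hlam Q M) ^t* = Hlam Q M.
Proof. by rewrite /Hlam !adjM !adjK hQ !mulmxA. Qed.

Lemma H0lam_herm : (H0lam Q M) ^t* = H0lam Q M.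
Proof.
by rewrite /H0lam adj_block_mx !adjD !adjN !adjM adjK hQ adj0 addrC.
Qed.

Lemma H1lam_herm : (H1lam Q M) ^t* = H1lam Q M.
Proof.
rewrite /H1lam adjZ adj_block_mx adj0 !(adjN, adjD, adjM) adjK hQ.
have -> : ('i%C : R[i])^* = - 'i%C.
  by apply/eqP; rewrite eq_complex /= oppr0 !eqxx.
rewrite scaleNr -scalerN opp_block_mx oppr0 opprK.
congr (_ *: block_mx _ _ _ _).
by rewrite opprD !opprK addrC.
Qed.

Lemma qform_Hlam x y : qform (Hlam Q M) (col_mx x y) = sqnorm (w x y).
Proof.
pose E := Q *m M *m row_mx 1%:M (- 1%:M).
have -> : Hlam Q M = E ^t* *m E by rewrite /Hlam /E !adjM hQ !mulmxA.
have -> : w x y = E *m col_mx x y.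
  by rewrite -(mulmxA (Q *m M)) mul_row_col mul1mx mulNmx mul1mx.
by rewrite qformE sqnormE -mulmxA cdot_adj adjK.
Qed.

Lemma qform_H0lam x y :
  qform (H0lam Q M) (col_mx x y) = 2 * reC (cdot (w x y) x).
Proof.
have -> : 2 * reC (cdot (w x y) x) = reC (cdot x (w x y) + cdot (w x y) x).
  by rewrite reCD (cdotC (w x y) x) reC_conj mulr2n mulrDl mul1r.
rewrite qformE /H0lam mul_block_col cdot_col_mx mul0mx addr0; congr reC.
rewrite -[in M ^t* *m Q]hQ -adjM /w; move: (Q *m M) => N.
rewrite mulmxDl !mulNmx mulmxBr !(cdotDl, cdotDr, cdotNl, cdotNr).
rewrite ![cdot _ (N ^t* *m _)]cdot_adj adjK; move: (N *m x) (N *m y) => a b.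
by ring.
Qed.

Lemma qform_H1lam x y :
  qform (H1lam Q M) (col_mx x y) = 2 * imC (cdot (w x y) y).
Proof.
have -> : 2 * imC (cdot (w x y) y) =
    reC ('i%C * (cdot y (w x y) - cdot (w x y) y)).
  rewrite (cdotC (w x y) y); case: (cdot _ _) => a b /=.
  by ring.
rewrite qformE /H1lam -scalemxAl cdotZr mul_block_col cdot_col_mx mul0mx add0r.
congr (reC (_ * _)).
rewrite -[in M ^t* *m Q]hQ -adjM /w; move: (Q *m M) => N.
rewrite mulmxDl !mulNmx mulmxBr !(cdotDl, cdotDr, cdotNl, cdotNr).
rewrite ![cdot _ (N ^t* *m _)]cdot_adj adjK; move: (N *m x) (N *m y) => a b.
by ring.
Qed.

End Pencil.

(* For every direction (t0, t1) the vector u below has w fixed and makes both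
   constraint terms large, which bounds [lambda_max] from below. *)
Lemma lambda_max_coercive (R : realType) n (Q M : 'M[R[i]]_n) :
  (0 < n)%N -> Q ^t* = Q -> Q *m M \in unitmx ->
  exists2 k : R, 0 < k & forall t0 t1, k * (1 + `|t0| + `|t1|) <=
    lambda_max (Hlam Q M + t0%:C *: H0lam Q M + t1%:C *: H1lam Q M).
Proof.
move=> n0 hQ uQM.
have [w w1] := sphere_nonempty R n0.
(* This choice makes Q M ((y + z) - z) = w for every z, leaving z free to tune the two linear
   terms. *)
pose y := invmx (Q *m M) *m w.
have wE : Q *m M *m y = w by rewrite /y mulKVmx.
pose be := reC (cdot w y).
(* The excess of r over |be| absorbs the term t0 be, whose sign is not controlled. *)
pose r := `|be| + 1.
have r0 : 0 < r by rewrite ltr_wpDl.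
(* This bounds |y + z|^2 + |z|^2, by |z|^2 = 2 r^2 and |y + z|^2 <= 2 |y|^2 + 2 |z|^2. *)
pose K := 6 * r ^+ 2 + 2 * sqnorm y.
have K0 : 0 < K.
  by rewrite ltr_pwDl // ?mulr_ge0 ?sqnorm_ge0 // mulr_gt0 // exprn_gt0.
exists K^-1 => [|t0 t1]; first by rewrite invr_gt0.
pose sg (t : R) := if 0 <= t then r else - r.
have sgE t : t * sg t = r * `|t|.
  rewrite /sg; case: (lerP 0 t) => ht.
    by rewrite (ger0_norm ht); ring.
  by rewrite (ltr0_norm ht); ring.
have sg2 t : sg t ^+ 2 = r ^+ 2 by rewrite /sg; case: ifP; rewrite ?sqrrN.
(* The real part of the factor drives the H_0 term, the imaginary part the H_1 term, each with the
   sign of its parameter. *)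
pose z := (sg t0 +i* sg t1) *: w.
have sz : sqnorm z = 2 * r ^+ 2 by rewrite sqnormZ /= !sg2 w1; ring.
have nn0 : (0 < n + n)%N by rewrite addn_gt0 n0.
have := qform_pencil_le nn0 (Hlam_herm M hQ) (H0lam_herm M hQ)
  (H1lam_herm M hQ) t0 t1 (col_mx (y + z) z).
rewrite qform_Hlam // qform_H0lam // qform_H1lam // addrK wE w1.
set mu := lambda_max _.
have -> : sqnorm (col_mx (y + z) z) = sqnorm (y + z) + sqnorm z.
  by rewrite !sqnormE cdot_col_mx reCD.
have le_yz : sqnorm (y + z) <= 2 * sqnorm y + 2 * sqnorm z.
  have := sqnorm_ge0 (1%:C *: y + (-1)%:C *: z); rewrite sqnorm_comb.
  have := sqnorm_comb 1 1 y z; rewrite !scale1r => ->; lra.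
rewrite sz in le_yz *.
have c1 : reC (cdot w (y + z)) = be + sg t0.
  by rewrite cdotDr reCD cdotZr cdotxx w1 /z reCM /= mulr1 mulr0 subr0.
have c2 : imC (cdot w z) = sg t1.
  by rewrite cdotZr cdotxx w1 imCM /= mulr1 mulr0 add0r.
rewrite c1 c2.
have be_le : - (`|be| * `|t0|) <= t0 * be.
  by rewrite -normrM mulrC lerNl -normrN ler_norm.
have -> : 1 + t0 * (2 * (be + sg t0)) + t1 * (2 * sg t1) =
   1 + 2 * (t0 * be) + 2 * (r * `|t0|) + 2 * (r * `|t1|).
  by rewrite -!sgE; ring.
move=> h; rewrite ler_pdivrMl //.
have h2 : 1 + `|t0| + `|t1| <= mu * (sqnorm (y + z) + 2 * r ^+ 2).
  apply: le_trans h.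
  have := normr_ge0 t0; have := normr_ge0 t1; have := normr_ge0 be.
  by rewrite /r => *; nra.
have mu0 : 0 < mu.
  rewrite ltNge; apply/negP => mu0.
  have := sqnorm_ge0 (y + z); have := normr_ge0 t0; have := normr_ge0 t1.
  have := sqr_ge0 r; nra.
apply: le_trans h2 _; rewrite mulrC ler_wpM2r ?(ltW mu0) // /K; lra.
Qed.

(** * Structured perturbations against the pencil *)

Lemma pdmx_unit (R : realType) n (Q : 'M[R[i]]_n) : pdmx Q -> Q \in unitmx.
Proof.
move=> [_ Qpos]; rewrite unitmxE unitfE; apply/negP; rewrite -det_tr.
move=> /det0P[v v0 vQ]; have := Qpos v^T; rewrite trmx_eq0 => /(_ v0).
by rewrite -mulmxA -[Q]trmxK -trmx_mul vQ trmx0 mulmx0 mxE ltxx.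
Qed.

(** Collecting the perturbation on the right leaves the matrix whose inverse is - M, so that v can
    be recovered as M (DJ - DR) Q v. *)
Lemma perturbed_eigenvector (R : realType) n (J Rm Q DJ DR : 'M[R[i]]_n)
    (lambda : R[i]) (v : 'cV[R[i]]_n) :
  (J + DJ - (Rm + DR)) *m Q *m v = lambda *: v <->
  ((J - Rm) *m Q - lambda%:M) *m v = - (DJ *m (Q *m v) - DR *m (Q *m v)).
Proof.
rewrite opprD addrACA !mulmxDl !mulNmx mul_scalar_mx !mulmxA.
set X := J *m Q *m v - _; set Y := DJ *m Q *m v - _.
split=> [<-|h]; first by rewrite opprD addrA subrr sub0r.
by rewrite -[Y]opprK -h opprB addrC subrK.
Qed.

(* Written with w = Q v, an eigenvector v of the perturbed matrix is
   v = M (DJ w - DR w), and structured perturbations make w^* DJ w imaginary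
   and w^* DR w real. *)
Lemma perturbation_lower_bound (R : realType) n (J Rm Q : 'M[R[i]]_n)
    (lambda : R[i]) (D : 'M[R[i]]_n * 'M[R[i]]_n) (t0 t1 : R) :
  let M := Mlam J Rm Q lambda in
  (0 < n)%N -> Q ^t* = Q -> Q \in unitmx ->
  (J - Rm) *m Q - lambda%:M \in unitmx ->
  pert_set D -> spectrum ((J + D.1 - (Rm + D.2)) *m Q) lambda ->
  1 <= lambda_max (Hlam Q M + t0%:C *: H0lam Q M + t1%:C *: H1lam Q M) *
    pair_norm D ^+ 2.
Proof.
move: D => [DJ DR] M n0 hQ uQ uN [hJ hR] sD; move: hJ hR => /= hJ hR.
have [v v0 Dv] := (eigenvalue_colP _ _).1 sD.
pose w := Q *m v; pose x := DJ *m w; pose y := DR *m w.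
have w0 : 0 < sqnorm w.
  rewrite sqnorm_gt0 //; apply: contra v0 => /eqP w0.
  by rewrite -[v](mulKmx uQ) -/w w0 mulmx0.
have vE : v = M *m (x - y).
  have Nv : ((J - Rm) *m Q - lambda%:M) *m v = - (x - y).
    exact/perturbed_eigenvector.
  by rewrite /M /Mlam mulNmx -mulmxN -Nv mulKmx.
have wE : Q *m M *m (x - y) = w by rewrite -mulmxA -vE.
have nn0 : (0 < n + n)%N by rewrite addn_gt0 n0.
have := qform_pencil_le nn0 (Hlam_herm M hQ) (H0lam_herm M hQ)
  (H1lam_herm M hQ) t0 t1 (col_mx x y).
rewrite qform_Hlam // qform_H0lam // qform_H1lam // wE.
rewrite (reC_skew w hJ) (imC_herm w hR) !mulr0 !addr0.
move: (lambda_max _) => mu.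
have -> : sqnorm (col_mx x y) = sqnorm x + sqnorm y.
  by rewrite !sqnormE cdot_col_mx reCD.
have := spectral_norm_ge DJ w; have := spectral_norm_ge DR w.
rewrite -/x -/y /pair_norm /= sqr_sqrtr ?addr_ge0 ?sqr_ge0 //.
move: (spectral_norm DJ) (spectral_norm DR) => sJ sR.
have := sqnorm_ge0 x; have := sqnorm_ge0 y => x0 y0 ly lx h.
(* The sign of mu lets it multiply the norm bounds on x and y; a negative mu would force |w|^2 <=
   0. *)
have mu0 : 0 <= mu.
  rewrite leNgt; apply/negP => mu0.
  have : 0 <= (- mu) * (sqnorm x + sqnorm y).
    by rewrite mulr_ge0 ?addr_ge0 // oppr_ge0 ltW.
  rewrite mulNr; lra.
rewrite -(ler_pM2r w0) mul1r; apply: le_trans h _.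
rewrite -mulrA ler_wpM2l //; lra.
Qed.

(** The vector v = M (x - y) satisfies Q v = w, and the two vanishing conditions are those for
    structured maps from w to x and from w to y. *)
Lemma perturbation_attained (R : realType) n (J Rm Q : 'M[R[i]]_n)
    (lambda : R[i]) (x y : 'cV[R[i]]_n) :
  let M := Mlam J Rm Q lambda in let w := Q *m M *m (x - y) in
  (0 < n)%N -> (J - Rm) *m Q - lambda%:M \in unitmx ->
  w != 0 -> reC (cdot w x) = 0 -> imC (cdot w y) = 0 ->
  exists D, [/\ pert_set D, spectrum ((J + D.1 - (Rm + D.2)) *m Q) lambda &
    pair_norm D ^+ 2 * sqnorm w = sqnorm x + sqnorm y].
Proof.
move=> M w n0 uN w0 wx wy.
have [DJ [hJ DJw nJ]] := skew_map_min_norm n0 w0 wx.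
have [DR [hR DRw nR]] := herm_map_min_norm n0 w0 wy.
exists (DJ, DR); split => //.
- apply/eigenvalue_colP; exists (M *m (x - y)).
    by apply: contra w0 => /eqP v0; rewrite /w -mulmxA v0 mulmx0.
  have Nv : ((J - Rm) *m Q - lambda%:M) *m (M *m (x - y)) = - (x - y).
    by rewrite /M /Mlam mulNmx mulmxN mulKVmx.
  apply/perturbed_eigenvector; rewrite Nv (mulmxA Q).
  by rewrite -/w DJw DRw.
- by rewrite /pair_norm sqr_sqrtr ?addr_ge0 ?sqr_ge0 // mulrDl nJ nR.
Qed.

(** For [n = 0] there are no eigenvalues and the backward error is [+oo]. Positivity of the minimum
    makes the power -1/2 a genuine inverse square root. *)
Theorem theorem3p8 (R : realType) (n : nat) (n_gt0 : (0 < n)%N)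
    (J Rm Q : 'M[R[i]]_n) (lambda : R[i])
    (J_skew : J ^t* = - J) (Rm_psd : psdmx Rm) (Q_pd : pdmx Q)
    (M_exists : (J - Rm) *m Q - lambda%:M \in unitmx) :
  let M := Mlam J Rm Q lambda in
  let f (t0 t1 : R) :=
    lambda_max (Hlam Q M + t0%:C *: H0lam Q M + t1%:C *: H1lam Q M) in
  exists t0 t1 : R,
    [/\ forall s0 s1 : R, f t0 t1 <= f s0 s1,
        0 < f t0 t1
      & backward_error J Rm Q lambda = (f t0 t1 `^ (- 2^-1))%:E].
Proof.
move=> M f.
have hQ := Q_pd.1; have uQ := pdmx_unit Q_pd.
have uM : M \in unitmx.
  by rewrite /M /Mlam -scaleN1r unitmxZ ?unitrN1 // unitmx_inv.
have uQM : Q *m M \in unitmx by rewrite unitmx_mul uQ.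
have nn0 : (0 < n + n)%N by rewrite addn_gt0 n_gt0.
have hH := Hlam_herm M hQ; have hH0 := H0lam_herm M hQ.
have hH1 := H1lam_herm M hQ.
have [k k0 fco] := lambda_max_coercive n_gt0 hQ uQM.
have [c0 [c1 [c00 c10 flip]]] := lambda_max_lipschitz nn0 hH hH0 hH1.
have [|t0 [t1 tmin]] := coercive_min c00 c10 k0 flip.
  move=> s0 s1; have := fco s0 s1; have := normr_ge0 s0; have := normr_ge0 s1.
  by split; nra.
exists t0, t1.
have f0 : 0 < f t0 t1.
  by apply: lt_le_trans (fco t0 t1); apply: mulr_gt0.
split=> //.
have [u [u1 u0 u0' uf]] := lambda_max_min_isotropic nn0 hH hH0 hH1 tmin.
rewrite -/(f t0 t1) in uf.
rewrite powRN powR12_sqrt ?(ltW f0) //.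
have sf0 : 0 < Num.sqrt (f t0 t1) by rewrite sqrtr_gt0.
have sf2 : Num.sqrt (f t0 t1) ^+ 2 = f t0 t1 by rewrite sqr_sqrtr ?ltW.
have pn0 D : 0 <= pair_norm D by exact: sqrtr_ge0.
apply/eqP; rewrite eq_le; apply/andP; split; last first.
  apply: le_ereal_inf_tmp => _ [D /= [hD sD] <-]; rewrite lee_fin.
  have := perturbation_lower_bound t0 t1 n_gt0 hQ uQ M_exists hD sD.
  rewrite -/M -/(f t0 t1) -{1}sf2 -exprMn => h.
  rewrite -[leLHS]mulr1 ler_pdivrMl //.
  rewrite -(@ler_pXn2r _ 2) ?nnegrE ?expr1n //.
  by apply: mulr_ge0 => //; exact: sqrtr_ge0.
(* The halves x and y of the isotropic top vector yield a perturbation attaining the lower bound. *)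
rewrite -[u]vsubmxK in u1 u0 u0' uf.
move: (usubmx u) (dsubmx u) => x y in u1 u0 u0' uf.
rewrite qform_H0lam // in u0; rewrite qform_H1lam // in u0'.
rewrite qform_Hlam // in uf; set w := Q *m M *m (x - y) in u0 u0' uf.
have w0 : w != 0.
  by apply/eqP => w0; move: f0; rewrite -uf w0 sqnormE cdot0r ltxx.
have wx : reC (cdot w x) = 0 by lra.
have wy : imC (cdot w y) = 0 by lra.
have [D [hD sD nD]] := perturbation_attained n_gt0 M_exists w0 wx wy.
have xy1 : sqnorm x + sqnorm y = 1.
  by rewrite -u1 !sqnormE cdot_col_mx reCD.
suff -> : (Num.sqrt (f t0 t1))^-1 = pair_norm D.
  by apply: ereal_inf_lbound; exists D.
apply/eqP; rewrite -(@eqrXn2 _ 2) ?invr_ge0 ?sqrtr_ge0 //.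
rewrite exprVn sf2 -uf; apply/eqP; apply: (mulIf (lt0r_neq0 f0)).
by rewrite -uf nD xy1 mulVf // uf lt0r_neq0.
Qed.
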